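(* Let $M,N$ be positive integers, and let $\mathbf{r}=[r_1,\ldots,r_M]$ and $\mathbf{c}=[c_1,\ldots,c_N]$ be positive vectors with $\Vert\mathbf{r}\Vert_1=\Vert\mathbf{c}\Vert_1=:s$. Let $\widetilde{A}\in\mathbb{R}^{M\times N}$ be a (deterministic) positive matrix and denote $a=\min_{i,j}\widetilde{A}_{i,j}$, $b=\max_{i,j}\widetilde{A}_{i,j}$. Suppose that there exist $\varepsilon\in(0,1)$ and positive vectors $\mathbf{x}=[x_1,\ldots,x_M]$ and $\mathbf{y}=[y_1,\ldots,y_N]$ such that $$\left\vert\frac{1}{c_j}\sum_{i=1}^M x_i\widetilde{A}_{i,j}y_j-1\right\vert\leq\varepsilon,\qquad\left\vert\frac{1}{r_i}\sum_{j=1}^N x_i\widetilde{A}_{i,j}y_j-1\right\vert\leq\varepsilon,$$ for all $i\in[M]$ and $j\in[N]$. Then $\widetilde{A}$ can be scaled to row sums $\mathbf{r}$ and column sums $\mathbf{c}$ by a pair $(\widetilde{\mathbf{x}},\widetilde{\mathbf{y}})$ that satisfies $$\frac{\vert\widetilde{x}_i-x_i\vert}{x_i}\leq\frac{\varepsilon}{1-\varepsilon}+\frac{4\varepsilon s\sqrt{b}}{a^2C_1^{3/2}C_2^{3/2}M\min_i r_i},$$ $$\frac{\vert\widetilde{y}_j-y_j\vert}{y_j}\leq\frac{\varepsilon}{1-\varepsilon}+\frac{4\varepsilon s\sqrt{b}}{a^2C_1^{3/2}C_2^{3/2}N\min_j c_j},$$ for all $i\in[M]$ and $j\in[N]$,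 where $C_1=\min_i\{x_i/\overline{r}_i\}$ and $C_2=\min_j\{y_j/\overline{c}_j\}$.
   Context: $[n]=\{1,\ldots,n\}$. A matrix or vector is positive if all its entries are strictly positive. $\overline{r}_i=r_i/\sqrt{\Vert\mathbf{r}\Vert_1}$ for $i\in[M]$ and $\overline{c}_j=c_j/\sqrt{\Vert\mathbf{c}\Vert_1}$ for $j\in[N]$. A pair of (positive) vectors $(\widetilde{\mathbf{x}},\widetilde{\mathbf{y}})\in\mathbb{R}^M\times\mathbb{R}^N$ scales $\widetilde{A}$ to row sums $\mathbf{r}$ and column sums $\mathbf{c}$ if $\sum_{j=1}^N\widetilde{x}_i\widetilde{A}_{i,j}\widetilde{y}_j=r_i$ for all $i\in[M]$ and $\sum_{i=1}^M\widetilde{x}_i\widetilde{A}_{i,j}\widetilde{y}_j=c_j$ for all $j\in[N]$. *)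

(* Defs.v *)
From mathcomp Require Import all_boot all_order all_algebra.
From mathcomp Require Import reals exp.
Set Implicit Arguments.
Unset Strict Implicit.
Unset Printing Implicit Defensive.
Import Order.TTheory GRing.Theory Num.Theory.
Local Open Scope ring_scope.

Definition positive_mx (R : realType) (m n : nat) (A : 'M[R]_(m, n)) : Prop :=
  forall i j, 0 < A i j.

(* The norm `|v| of the library on matrices is the max norm. *)
Definition norm1 (R : realType) (n : nat) (v : 'rV[R]_n) : R :=
  \sum_(i < n) `|v 0 i|.

(* The index i0 only witnesses that I is nonempty; see fmin_indep and
   fmax_indep. *)
Definition fmin (R : realType) (I : finType) (i0 : I) (F : I -> R) : R :=
  \big[Num.min/F i0]_(i : I) F i.

Definition fmax (R : realType) (I : finType) (i0 : I) (F : I -> R) : R :=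
  \big[Num.max/F i0]_(i : I) F i.

Lemma fmin_le (R : realType) (I : finType) (i0 : I) (F : I -> R) (i : I) :
  fmin i0 F <= F i.
Proof. exact: bigmin_le_cond. Qed.

Lemma fmin_attained (R : realType) (I : finType) (i0 : I) (F : I -> R) :
  exists i, fmin i0 F = F i.
Proof.
rewrite /fmin; elim/big_ind: _ => [|x y [i ->] [j ->]|i _].
- by exists i0.
- by rewrite minEle; case: ifP => _; [exists i | exists j].
- by exists i.
Qed.

Lemma fmin_indep (R : realType) (I : finType) (i0 i1 : I) (F : I -> R) :
  fmin i0 F = fmin i1 F.
Proof.
have [i Ei] := fmin_attained i0 F; have [j Ej] := fmin_attained i1 F.
apply/eqP; rewrite eq_le; apply/andP; split.
- by rewrite Ej fmin_le.
- by rewrite Ei fmin_le.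
Qed.

Lemma fmax_ge (R : realType) (I : finType) (i0 : I) (F : I -> R) (i : I) :
  F i <= fmax i0 F.
Proof. exact: le_bigmax_cond. Qed.

Lemma fmax_attained (R : realType) (I : finType) (i0 : I) (F : I -> R) :
  exists i, fmax i0 F = F i.
Proof.
rewrite /fmax; elim/big_ind: _ => [|x y [i ->] [j ->]|i _].
- by exists i0.
- by rewrite maxEle; case: ifP => _; [exists j | exists i].
- by exists i.
Qed.

Lemma fmax_indep (R : realType) (I : finType) (i0 i1 : I) (F : I -> R) :
  fmax i0 F = fmax i1 F.
Proof.
have [i Ei] := fmax_attained i0 F; have [j Ej] := fmax_attained i1 F.
apply/eqP; rewrite eq_le; apply/andP; split.
- by rewrite Ei fmax_ge.
- by rewrite Ej fmax_ge.
Qed.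

Definition vmin (R : realType) (n : nat) (hn : (0 < n)%N) (v : 'rV[R]_n) : R :=
  fmin (Ordinal hn) (fun i => v 0 i).

Definition mx_min (R : realType) (m n : nat) (hm : (0 < m)%N) (hn : (0 < n)%N)
    (A : 'M[R]_(m, n)) : R :=
  fmin (Ordinal hm, Ordinal hn) (fun ij => A ij.1 ij.2).

Definition mx_max (R : realType) (m n : nat) (hm : (0 < m)%N) (hn : (0 < n)%N)
    (A : 'M[R]_(m, n)) : R :=
  fmax (Ordinal hm, Ordinal hn) (fun ij => A ij.1 ij.2).

Definition normalized (R : realType) (n : nat) (v : 'rV[R]_n) : 'rV[R]_n :=
  \row_(i < n) (v 0 i / Num.sqrt (norm1 v)).

Definition scales (R : realType) (m n : nat) (A : 'M[R]_(m, n))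
    (r : 'rV[R]_m) (c : 'rV[R]_n) (x : 'rV[R]_m) (y : 'rV[R]_n) : Prop :=
  [/\ positive_mx x,
      positive_mx y,
      forall i : 'I_m, \sum_(j < n) x 0 i * A i j * y 0 j = r 0 i
    & forall j : 'I_n, \sum_(i < m) x 0 i * A i j * y 0 j = c 0 j].

(* Main.v *)
Require Import Defs.
From mathcomp Require Import all_boot all_order all_algebra.
From mathcomp Require Import reals exp.
From mathcomp Require Import classical_sets topology normedtype derive.
From mathcomp Require Import ring lra.
Set Implicit Arguments.
Unset Strict Implicit.
Unset Printing Implicit Defensive.
Import Order.TTheory GRing.Theory Num.Theory numFieldNormedType.Exports.
Local Open Scope classical_set_scope.
Local Open Scope ring_scope.

(* Existence of the exact scaling: the Sinkhorn map T on positive column vectors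
   is homogeneous and strictly monotone.  It maps positive vectors, up to a
   factor, into a compact box, on which max_j (T v)_j / v_j attains its minimum.
   A minimiser is an eigenvector of T, and comparing total masses shows that
   its eigenvalue is 1.

   Perturbation: put B_ij = x_i A_ij y_j and let (u, v) scale B exactly,
   normalised so that max u = max v = W.  Since B_ij >= q r_i c_j / s for
   q = a C1 C2, a Doeblin argument gives q (W - min u) <= 2 eps (W + min u),
   hence W - min u <= 4 eps W / q.  As W * min u <= 1 / (1 - eps) and
   W^2 >= 1 / (1 + eps), the interval [min u, W] lies within
   eps / (1 - eps) + 4 eps W / q of 1.  Finally the entries of the exact scaling
   satisfy xt_i yt_j <= b r_i c_j / (a^2 s), so W^2 <= b / (a^2 C1 C2). *)

(** * Finite extrema and strictly positive sums *)

Lemma cvg_fmax (T : topologicalType) (R : realType) (I : finType)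
    (i0 : I) (F : I -> T -> R) (t : T) :
  (forall i, F i t' @[t' --> t] --> F i t) ->
  fmax i0 (F ^~ t') @[t' --> t] --> fmax i0 (F ^~ t).
Proof.
move=> cF; rewrite /fmax; elim: (index_enum I) => [|i s IH].
  (* The default value of the maximum is [F i0], so the empty list is an instance of [cF]. *)
  by rewrite big_nil; under eq_cvg do rewrite big_nil; exact: cF.
rewrite big_cons; under eq_cvg do rewrite big_cons.
exact: (continuous_max (cF i) IH).
Qed.

Lemma fmax_lt (R : realType) (I : finType) (i0 : I) (F : I -> R) (t : R) :
  (forall i, F i < t) -> fmax i0 F < t.
Proof. by move=> Ft; have [i ->] := fmax_attained i0 F. Qed.

Lemma fmin_gt (R : realType) (I : finType) (i0 : I) (F : I -> R) (t : R) :
  (forall i, t < F i) -> t < fmin i0 F.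
Proof. by move=> Ft; have [i ->] := fmin_attained i0 F. Qed.

Lemma ltr_sum_strict (R : realType) (I : finType) (F G : I -> R) :
  (forall i, F i <= G i) -> (exists i, F i < G i) ->
  \sum_i F i < \sum_i G i.
Proof.
move=> FG [i FGi]; rewrite (bigD1 i) // [ltRHS](bigD1 i) //=.
by apply: ltr_leD => //; apply: ler_sum.
Qed.

Lemma sumr_ord_gt0 (R : realType) (n : nat) (F : 'I_n -> R) :
  (0 < n)%N -> (forall i, 0 < F i) -> 0 < \sum_i F i.
Proof.
move=> n0 F0.
have : \sum_(i < n) 0 < \sum_i F i.
  by apply: ltr_sum_strict => [i|]; [exact/ltW | exists (Ordinal n0)].
by rewrite big1_eq.
Qed.

(** * The half step of the Sinkhorn iteration *)

Section SinkhornStep.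
Context {R : realType}.

(** The row update of Sinkhorn: the unique [u] for which [u_i A_ij v_j] has row sums [r]. With [A^T]
    and [c] it becomes the column update. *)
Definition half_step m n (A : 'M[R]_(m, n)) (r : 'rV[R]_m) (v : 'rV[R]_n) :
    'rV[R]_m :=
  \row_i (r 0 i / \sum_j A i j * v 0 j).

Section HalfStep.
Context {m n : nat} (n_gt0 : (0 < n)%N).
Variables (A : 'M[R]_(m, n)) (r : 'rV[R]_m).
Hypotheses (A_pos : positive_mx A) (r_pos : positive_mx r).

Lemma half_step_sum_gt0 (v : 'rV[R]_n) (i : 'I_m) :
  positive_mx v -> 0 < \sum_j A i j * v 0 j.
Proof. by move=> v0; apply: sumr_ord_gt0 => // j; rewrite mulr_gt0. Qed.

Lemma half_step_pos (v : 'rV[R]_n) :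
  positive_mx v -> positive_mx (half_step A r v).
Proof.
by move=> v0 k i; rewrite (ord1 k) mxE divr_gt0 // half_step_sum_gt0.
Qed.

Lemma half_stepK (v : 'rV[R]_n) (i : 'I_m) : positive_mx v ->
  half_step A r v 0 i * \sum_j A i j * v 0 j = r 0 i.
Proof. by move=> v0; rewrite mxE divfK // gt_eqF // half_step_sum_gt0. Qed.

Lemma half_stepZ (t : R) (v : 'rV[R]_n) :
  half_step A r (t *: v) = t^-1 *: half_step A r v.
Proof.
apply/rowP => i; rewrite !mxE mulrCA -invfM mulr_sumr.
by congr (_ / _); apply: eq_bigr => j _; rewrite mxE mulrCA.
Qed.

Lemma half_step_le (v w : 'rV[R]_n) (i : 'I_m) :
  positive_mx v -> (forall j, v 0 j <= w 0 j) ->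
  half_step A r w 0 i <= half_step A r v 0 i.
Proof.
move=> v0 vw; rewrite !mxE ler_pM2l // lef_pV2 ?posrE ?half_step_sum_gt0 //.
  by apply: ler_sum => j _; rewrite ler_pM2l.
by move=> k j; rewrite (ord1 k) (lt_le_trans (v0 0 j)).
Qed.

(** Since every entry of [A] is positive, strictness at a single [j] enters all the sums and so
    reaches every [i]. *)
Lemma half_step_lt (v w : 'rV[R]_n) (i : 'I_m) :
  positive_mx v -> (forall j, v 0 j <= w 0 j) -> (exists j, v 0 j < w 0 j) ->
  half_step A r w 0 i < half_step A r v 0 i.
Proof.
move=> v0 vw [j vwj].
rewrite !mxE ltr_pM2l // ltf_pV2 ?posrE ?half_step_sum_gt0 //.
  apply: ltr_sum_strict => [k|]; first by rewrite ler_pM2l.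
  by exists j; rewrite ltr_pM2l.
by move=> k l; rewrite (ord1 k) (lt_le_trans (v0 0 l)).
Qed.

(** Cross-multiplied, this compares [a] times the [i]-th sum with [b] times the [k]-th one;
    termwise, [A k j * A i j] lies in between. The factor does not depend on [v], which is what
    confines the images to a compact box. *)
Lemma half_step_ratio (a b : R) (v : 'rV[R]_n) (i k : 'I_m) :
  0 < b -> (forall i j, a <= A i j <= b) -> positive_mx v ->
  r 0 i * a / (r 0 k * b) * half_step A r v 0 k <= half_step A r v 0 i.
Proof.
move=> b0 Aab v0; rewrite !mxE.
have Si := half_step_sum_gt0 i v0; have Sk := half_step_sum_gt0 k v0.
rewrite -[leLHS]mulrA (_ : _ * _ = r 0 i * (a / (b * \sum_j A k j * v 0 j))).
  rewrite ler_pM2l // ler_pdivrMr ?mulr_gt0 // mulrC ler_pdivlMr //.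
  rewrite !mulr_sumr; apply: ler_sum => j _; rewrite !mulrA ler_pM2r //.
  have /andP[aAk Akb] := Aab k j; have /andP[aAi Aib] := Aab i j.
  rewrite (le_trans (y := A k j * A i j)) ?ler_pM2r //.
  by rewrite mulrC ler_pM2r.
by field; rewrite !gt_eqF.
Qed.

End HalfStep.

(** Stated along a map [f] so that it composes: [f] is the identity for the row update and the row
    update itself for the column update. *)
Lemma cvg_half_step (T : topologicalType) m n (A : 'M[R]_(m, n))
    (r : 'rV[R]_m) (f : T -> 'rV[R]_n) (t : T) (i : 'I_m) :
  (0 < n)%N -> positive_mx A -> positive_mx (f t) ->
  (forall j, f t' 0 j @[t' --> t] --> f t 0 j) ->
  half_step A r (f t') 0 i @[t' --> t] --> half_step A r (f t) 0 i.
Proof.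
move=> n0 A0 ft0 cf.
rewrite mxE; under eq_cvg do rewrite mxE.
apply: cvgM; first exact: cvg_cst.
apply: cvgV; first by rewrite gt_eqF // half_step_sum_gt0.
elim: (index_enum _) => [|j s IH].
  by rewrite big_nil; under eq_cvg do rewrite big_nil; exact: cvg_cst.
rewrite big_cons; under eq_cvg do rewrite big_cons.
by apply: cvgD => //; apply: cvgM => //; exact: cvg_cst.
Qed.

End SinkhornStep.

(** * Existence of an exact scaling *)

Lemma positive_mx_tr (R : realType) m n (A : 'M[R]_(m, n)) :
  positive_mx A -> positive_mx A^T.
Proof. by move=> A0 i j; rewrite mxE. Qed.

Section Sinkhorn.
Context {R : realType} {m n : nat} (m_gt0 : (0 < m)%N) (n_gt0 : (0 < n)%N).
Variables (A : 'M[R]_(m, n)) (r : 'rV[R]_m) (c : 'rV[R]_n).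
Hypotheses (A_pos : positive_mx A) (r_pos : positive_mx r) (c_pos : positive_mx c).

Let j0 := Ordinal n_gt0.
Let At_pos : positive_mx A^T := positive_mx_tr A_pos.
Let T (v : 'rV[R]_n) := half_step A^T c (half_step A r v).

Let T_pos v : positive_mx v -> positive_mx (T v).
Proof. by move=> v0; do 2!apply: half_step_pos => //. Qed.

Let TZ t (v : 'rV[R]_n) : T (t *: v) = t *: T v.
Proof. by rewrite /T !half_stepZ invrK. Qed.

Let T_lt (v w : 'rV[R]_n) j : positive_mx v -> (forall j, v 0 j <= w 0 j) ->
  (exists j, v 0 j < w 0 j) -> T v 0 j < T w 0 j.
Proof.
move=> v0 vw vwj.
have w0 : positive_mx w by move=> k l; rewrite (ord1 k) (lt_le_trans (v0 0 l)).
apply: half_step_lt => //; first exact: half_step_pos.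
  by move=> i; exact: half_step_le.
(* Each half step reverses the order. The outer one asks for strictness at some row only, and the
   inner one gives it at every row. *)
by exists (Ordinal m_gt0); exact: half_step_lt.
Qed.

(** The upper Collatz-Wielandt quotient: the least [t] with [T v <= t *: v] entrywise. *)
Let phi (v : 'rV[R]_n) := fmax j0 (fun j => T v 0 j / v 0 j).

Let phiZ t (v : 'rV[R]_n) : 0 < t -> phi (t *: v) = phi v.
Proof.
move=> t0; rewrite /phi /fmax TZ !mxE -mulf_div divff ?mul1r ?gt_eqF //.
by apply: eq_bigr => j _; rewrite !mxE -mulf_div divff ?mul1r ?gt_eqF.
Qed.

Let le_phi v j : positive_mx v -> T v 0 j <= phi v * v 0 j.
Proof. by move=> v0; rewrite -ler_pdivrMr //; exact: fmax_ge. Qed.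

(** The constant of [half_step_ratio] for [A^T] and [c], made uniform over all pairs of columns. *)
Let delta := fmin (j0, j0) (fun jk : 'I_n * 'I_n =>
  c 0 jk.1 * mx_min m_gt0 n_gt0 A / (c 0 jk.2 * mx_max m_gt0 n_gt0 A)).

Let delta_gt0 : 0 < delta.
Proof.
apply: fmin_gt => -[j k] /=; rewrite divr_gt0 // mulr_gt0 //.
  exact: fmin_gt.
by apply: lt_le_trans (fmax_ge _ _ (Ordinal m_gt0, j0)); exact: A_pos.
Qed.

Let box : set 'rV[R]_n := [set v | forall j, `[delta, 1]%classic (v 0 j)].

(** Division by the largest entry of [T v] caps the entries at 1, and [half_step_ratio] then keeps
    them above [delta]. *)
Let T_box v : positive_mx v -> exists2 t, 0 < t & box (t *: T v).
Proof.
move=> v0; have Tv0 := T_pos v0.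
have [k Ek] := fmax_attained j0 (fun j => T v 0 j).
exists (T v 0 k)^-1; first by rewrite invr_gt0.
move=> j /=; rewrite in_itv /= mxE [_^-1 * _]mulrC; apply/andP; split.
  rewrite ler_pdivlMr //.
  have dle : delta <= _ := fmin_le _ _ (j, k).
  apply: le_trans (ler_wpM2r (ltW (Tv0 0 k)) dle) _.
  apply: half_step_ratio => //; last exact: half_step_pos.
    by apply: lt_le_trans (fmax_ge _ _ (Ordinal m_gt0, j0)); exact: A_pos.
  move=> i l; rewrite mxE; apply/andP; split.
    exact: (fmin_le _ (fun ij => A ij.1 ij.2) (l, i)).
  exact: (fmax_ge _ (fun ij => A ij.1 ij.2) (l, i)).
by rewrite ler_pdivrMr // mul1r -Ek fmax_ge.
Qed.

Let box_pos v : box v -> positive_mx v.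
Proof.
move=> vb k j; rewrite (ord1 k).
by have := vb j; rewrite /= in_itv /= => /andP[+ _]; exact: lt_le_trans.
Qed.

(** The comparison is with [phi (T w)] because it is [T w], not [w], that can be rescaled into the
    box; [phiZ] makes the rescaling harmless. The eigenvector argument uses the case [w = v]. *)
Let phi_min : exists2 v, positive_mx v &
  forall w, positive_mx w -> phi v <= phi (T w).
Proof.
have box0 : box !=set0.
  pose v : 'rV[R]_n := const_mx 1.
  have [|t _ tv] := @T_box v; last by exists (t *: T v).
  by move=> i j; rewrite mxE.
have cbox : compact box.
  apply: (@rV_compact _ _ (fun=> `[delta, 1]%classic)) => j.
  exact: segment_compact.
have cphi : {within box, continuous phi}.
  apply: continuous_in_subspaceT => v /[1!inE] /box_pos v0.
  have cv j : (fun w : 'rV[R]_n => w 0 j) w @[w --> v] --> v 0 j.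
    exact: coord_continuous.
  have cu i : half_step A r w 0 i @[w --> v] --> half_step A r v 0 i.
    exact: (cvg_half_step (f := @id 'rV[R]_n) n_gt0 A_pos v0 cv).
  have u0 := half_step_pos n_gt0 A_pos r_pos v0.
  have cTv j : T w 0 j @[w --> v] --> T v 0 j.
    exact: (cvg_half_step (f := half_step A r) m_gt0 At_pos u0 cu).
  have cT j : T w 0 j / w 0 j @[w --> v] --> T v 0 j / v 0 j.
    by apply: (cvgM (cTv j) (cvgV _ (cv j))); rewrite gt_eqF.
  exact: (cvg_fmax (F := fun j (w : 'rV[R]_n) => T w 0 j / w 0 j) cT).
have [v + vmin] := EVT_min_rV box0 cbox cphi.
rewrite inE => /box_pos v0; exists v => // w w0.
by have [t t0 tw] := T_box w0; rewrite -(phiZ (T w) t0) vmin // inE.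
Qed.

(* If [T v <> phi v *: v], strict monotonicity of T gives
   [T (T v) < phi v *: T v] in every entry, contradicting minimality. *)
Let T_eigen : exists v, positive_mx v /\ T v = phi v *: v.
Proof.
have [v v0 vmin] := phi_min; exists v; split=> //.
apply/rowP => j; rewrite [RHS]mxE; apply/eqP.
rewrite eq_le le_phi //= leNgt; apply/negP => Tvj.
have := vmin v v0; rewrite leNgt => /negP; apply; apply: fmax_lt => k.
rewrite ltr_pdivrMr; last exact: T_pos.
rewrite (_ : phi v * T v 0 k = T (phi v *: v) 0 k); last by rewrite TZ [RHS]mxE.
apply: T_lt; first exact: T_pos.
  by move=> l; rewrite [leRHS]mxE le_phi.
by exists j; rewrite [ltRHS]mxE.
Qed.

Theorem sinkhorn : norm1 r = norm1 c -> exists u v, scales A r c u v.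
Proof.
have [v [v0 Tv]] := T_eigen; set u := half_step A r v.
have u0 : positive_mx u by exact: half_step_pos.
have rows i : \sum_j u 0 i * A i j * v 0 j = r 0 i.
  rewrite -(half_stepK n_gt0 r A_pos i v0) mulr_sumr.
  by apply: eq_bigr => j _; rewrite mulrA.
(* The eigenvector equation gives all column sums the right size up to the common factor [phi v];
   summing over all entries then forces this factor to be 1. *)
have cols j : phi v * \sum_i u 0 i * A i j * v 0 j = c 0 j.
  rewrite -(half_stepK m_gt0 c At_pos j u0) -/(T v) Tv mxE -mulrA.
  congr (_ * _); rewrite !mulr_sumr.
  by apply: eq_bigr => i _; rewrite [A^T _ _]mxE; ring.
rewrite /norm1; under eq_bigr do rewrite gtr0_norm //.
under [X in _ = X -> _]eq_bigr do rewrite gtr0_norm // -cols.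
rewrite -mulr_sumr exchange_big /=; under [X in _ = _ * X -> _]eq_bigr do rewrite rows.
move=> /esym rE.
have phi1 : phi v = 1.
  apply: (mulIf (x := \sum_i r 0 i)); last by rewrite mul1r.
  by rewrite gt_eqF // sumr_ord_gt0.
by exists u, v; split=> // j; rewrite -(cols j) phi1 mul1r.
Qed.

End Sinkhorn.

(** * Estimates for approximately scaled rows *)

Lemma tr_scales (R : realType) m n (A : 'M[R]_(m, n)) r c u v :
  scales A r c u v -> scales A^T c r v u.
Proof.
case=> u0 v0 rows cols; split=> // [j|i].
  by rewrite -cols; apply: eq_bigr => i _; rewrite mxE; ring.
by rewrite -rows; apply: eq_bigr => j _; rewrite mxE; ring.
Qed.

(** Formulated for rows alone: the column condition is [row_near eps B^T c], so each estimate below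
    also serves for columns. *)
Definition row_near (R : realType) m n (eps : R) (B : 'M[R]_(m, n))
    (r : 'rV[R]_m) : Prop :=
  forall i, `|(r 0 i)^-1 * \sum_j B i j - 1| <= eps.

Section RowEstimates.
Context {R : realType} {m n : nat}.
Variables (eps : R) (B : 'M[R]_(m, n)) (r u : 'rV[R]_m) (v : 'rV[R]_n).
Hypotheses (B_pos : positive_mx B) (r_pos : positive_mx r).
Hypotheses (u_pos : positive_mx u) (B_row : row_near eps B r).
Hypothesis uBv : forall i, \sum_j u 0 i * B i j * v 0 j = r 0 i.

Lemma row_near_bounds i :
  (1 - eps) * r 0 i <= \sum_j B i j <= (1 + eps) * r 0 i.
Proof.
by have := B_row i; rewrite ler_distl mulrC ler_pdivlMr // ler_pdivrMr.
Qed.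

Lemma row_sumE i : u 0 i * \sum_j B i j * v 0 j = r 0 i.
Proof.
by rewrite -[RHS]uBv mulr_sumr; apply: eq_bigr => j _; rewrite mulrA.
Qed.

(** In [u_i * \sum_j B_ij v_j = r_i], replace each [v_j] by its lower bound [t] and the row sum of
    [B] by [(1 - eps) * r_i]. The lemma [row_le] is the mirror image. *)
Lemma row_ge i (t : R) : 0 <= t -> (forall j, t <= v 0 j) ->
  u 0 i * t * (1 - eps) <= 1.
Proof.
move=> t0 tv; rewrite -(ler_pM2r (r_pos 0 i)) mul1r -[leRHS]row_sumE.
rewrite -!mulrA ler_pM2l //.
have /andP[Bi _] := row_near_bounds i.
apply: le_trans (ler_wpM2l t0 Bi) _; rewrite mulr_sumr.
by apply: ler_sum => j _; rewrite mulrC ler_pM2l.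
Qed.

Lemma row_le i (t : R) : 0 <= t -> (forall j, v 0 j <= t) ->
  1 <= u 0 i * t * (1 + eps).
Proof.
move=> t0 vt; rewrite -(ler_pM2r (r_pos 0 i)) mul1r -[leLHS]row_sumE.
rewrite -!mulrA ler_pM2l //.
have /andP[_ Bi] := row_near_bounds i.
apply: le_trans _ (ler_wpM2l t0 Bi); rewrite mulr_sumr.
by apply: ler_sum => j _; rewrite [leRHS]mulrC ler_pM2l.
Qed.

(* Doeblin minorisation: the part [q * w] of the rows of B is common to all of
   them, and cancels in the difference of two rows. *)
Lemma row_inv_gap (q t T : R) (w : 'I_n -> R) i k :
  (forall i j, q * r 0 i * w j <= B i j) -> \sum_j w j = 1 ->
  0 <= t <= T -> (forall j, t <= v 0 j <= T) ->
  (u 0 i)^-1 - (u 0 k)^-1 <= (1 - q) * (T - t) + eps * (T + t).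
Proof.
move=> qB w1 /andP[t0 tT] tvT.
pose d l j := (r 0 l)^-1 * B l j - q * w j.
have d0 l j : 0 <= d l j by rewrite subr_ge0 ler_pdivlMl // mulrCA mulrA.
(* The inverse of [u_l] is the sum of the [v_j] with weights [B_lj / r_l]; each weight splits into
   the remainder [d l j] and the common part [q * w j]. *)
have uE l : (u 0 l)^-1 = \sum_j d l j * v 0 j + q * \sum_j w j * v 0 j.
  rewrite mulr_sumr -big_split /=.
  under eq_bigr do rewrite mulrBl -[q * _ * _]mulrA subrK -mulrA.
  rewrite -mulr_sumr -[in RHS](row_sumE l) invfM -mulrA mulVf ?mulr1 //.
  by apply: contraTneq (r_pos 0 l) => S0; rewrite -row_sumE S0 mulr0 ltxx.
have dE l : \sum_j d l j = (r 0 l)^-1 * (\sum_j B l j) - q.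
  by rewrite sumrB -!mulr_sumr w1 mulr1.
have T0 := le_trans t0 tT.
have ub : \sum_j d i j * v 0 j <= (1 + eps - q) * T.
  apply: (le_trans (y := (\sum_j d i j) * T)).
    rewrite mulr_suml; apply: ler_sum => j _; apply: ler_wpM2l => //.
    by have /andP[] := tvT j.
  rewrite ler_wpM2r // dE lerD2r.
  by have := B_row i; rewrite ler_distl => /andP[].
have lb : (1 - eps - q) * t <= \sum_j d k j * v 0 j.
  apply: (le_trans (y := (\sum_j d k j) * t)).
    rewrite ler_wpM2r // dE lerD2r.
    by have := B_row k; rewrite ler_distl => /andP[].
  rewrite mulr_suml; apply: ler_sum => j _; apply: ler_wpM2l => //.
  by have /andP[] := tvT j.
(* The common parts cancel, and [(1 + eps - q) * T - (1 - eps - q) * t] is the claimed bound. *)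
rewrite !uE; lra.
Qed.

End RowEstimates.

(** * Distance of a balanced exact scaling from the all-ones vectors *)

Section ScalingPerturbation.
Context {R : realType} {m n : nat} (m_gt0 : (0 < m)%N) (n_gt0 : (0 < n)%N).
Variables (eps : R) (B : 'M[R]_(m, n)) (r u : 'rV[R]_m) (c v : 'rV[R]_n) (q : R).
Hypotheses (eps_ge0 : 0 <= eps) (eps_lt1 : eps < 1) (q_gt0 : 0 < q).
Hypotheses (B_pos : positive_mx B) (r_pos : positive_mx r) (c_pos : positive_mx c).
Hypotheses (B_row : row_near eps B r) (B_col : row_near eps B^T c).
Hypothesis B_ge : forall i j, q * r 0 i * c 0 j <= (\sum_i r 0 i) * B i j.
Hypothesis Buv : scales B r c u v.

Let U := fmax (Ordinal m_gt0) (u 0).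
Let u0 := fmin (Ordinal m_gt0) (u 0).
Let V := fmax (Ordinal n_gt0) (v 0).
Let v0 := fmin (Ordinal n_gt0) (v 0).

(** The Doeblin estimate for [B^T], with weights [r_i / \sum_i r_i], bounds [v0^-1 - V^-1]. This
    difference is at least [(1 - eps) * U - (1 + eps) * u0] by [row_ge] and [row_le], so the terms
    without [q] cancel up to [eps]. *)
Lemma scaling_spread : q * (U - u0) <= 2 * eps * (U + u0).
Proof.
have [u_pos v_pos rows cols] := Buv.
have [_ _ colsT _] := tr_scales Buv.
have Bt_pos := positive_mx_tr B_pos.
have u0_gt0 : 0 < u0 by apply: fmin_gt.
have v0_gt0 : 0 < v0 by apply: fmin_gt.
have u0U : u0 <= U by apply: le_trans (fmin_le _ _ _) (fmax_ge _ _ (Ordinal m_gt0)).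
have v0V : v0 <= V by apply: le_trans (fmin_le _ _ _) (fmax_ge _ _ (Ordinal n_gt0)).
have r_gt0 : 0 < \sum_i r 0 i by apply: sumr_ord_gt0.
have [iU EU] := fmax_attained (Ordinal m_gt0) (u 0).
have [iu Eu] := fmin_attained (Ordinal m_gt0) (u 0).
have [jV EV] := fmax_attained (Ordinal n_gt0) (v 0).
have [jv Ev] := fmin_attained (Ordinal n_gt0) (v 0).
have uU i : u0 <= u 0 i <= U by rewrite fmin_le fmax_ge.
have := row_inv_gap c_pos B_col colsT (q := q) (t := u0) (T := U)
  (w := fun i => r 0 i / \sum_i r 0 i) jv jV.
rewrite -Ev -EV -/v0 -/V => gap.
have {}gap : v0^-1 - V^-1 <= (1 - q) * (U - u0) + eps * (U + u0).
  apply: gap => //; last by rewrite ltW.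
    by move=> j i; rewrite mxE mulrA ler_pdivrMr // mulrAC [B i j * _]mulrC.
  by rewrite -mulr_suml divff // gt_eqF.
have Ule : U * v0 * (1 - eps) <= 1.
  rewrite /U EU; apply: (row_ge B_pos r_pos u_pos B_row rows) => [|j]; first exact: ltW.
  exact: fmin_le.
have uge : 1 <= u0 * V * (1 + eps).
  rewrite /u0 Eu; apply: (row_le B_pos r_pos u_pos B_row rows) => [|j].
    exact: le_trans (ltW v0_gt0) v0V.
  exact: fmax_ge.
have : (1 - eps) * U <= v0^-1.
  by rewrite -[leRHS]mul1r ler_pdivlMr // mulrAC mulrC mulrA mulrAC.
have : V^-1 <= (1 + eps) * u0.
  rewrite -[leLHS]mul1r ler_pdivrMr ?(lt_le_trans v0_gt0) //.
  by rewrite -mulrA mulrC.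
lra.
Qed.

(** Taking the common maximum [W] as a parameter lets the transposed instance, where [U] and [V]
    trade places, yield a bound with the same [W]. *)
Theorem scaling_close (W : R) (i : 'I_m) : U = W -> V = W ->
  `|u 0 i - 1| <= eps / (1 - eps) + 4 * eps * (W / q).
Proof.
move=> UW VW.
have [u_pos v_pos rows cols] := Buv.
have [_ _ colsT _] := tr_scales Buv.
have Bt_pos := positive_mx_tr B_pos.
have u0_gt0 : 0 < u0 by apply: fmin_gt.
have u0W : u0 <= W.
  by rewrite -UW; apply: le_trans (fmin_le _ _ _) (fmax_ge _ _ (Ordinal m_gt0)).
have W_gt0 := lt_le_trans u0_gt0 u0W.
have spread : W - u0 <= 4 * eps * (W / q).
  rewrite mulrA ler_pdivlMr // mulrC -{1}UW; apply: le_trans scaling_spread _.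
  rewrite UW; have : eps * (W + u0) <= eps * (W + W) by rewrite ler_wpM2l // lerD2l.
  lra.
have [jV EV] := fmax_attained (Ordinal n_gt0) (v 0).
have Wu0 : W * u0 * (1 - eps) <= 1.
  rewrite -VW /V EV; apply: (row_ge Bt_pos c_pos v_pos B_col colsT) => [|k].
    exact: ltW.
  exact: fmin_le.
have WW : 1 <= W * W * (1 + eps).
  rewrite -{1}VW /V EV; apply: (row_le Bt_pos c_pos v_pos B_col colsT) => [|k].
    exact: ltW.
  by rewrite -UW fmax_ge.
have eps1 : 0 < 1 - eps by rewrite subr_gt0.
have E : eps / (1 - eps) = (1 - eps)^-1 - 1 by field; rewrite gt_eqF.
have epsE : eps <= eps / (1 - eps).
  by rewrite ler_pdivlMr // ler_piMr // gerBl.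
(* If [u0] exceeded [1 / (1 - eps)], then [W >= u0 > 1] would make [W * u0 * (1 - eps)] exceed 1. *)
have u0_le : u0 <= 1 + eps / (1 - eps).
  rewrite E addrC subrK -[leRHS]mul1r ler_pdivlMr // leNgt; apply/negP => h.
  suff : 1 < W * u0 * (1 - eps) by rewrite ltNge Wu0.
  have u01 : 1 < u0 by apply: lt_le_trans h _; rewrite ler_piMr ?gerBl // ltW.
  rewrite -mulrA; apply: lt_le_trans h _.
  by rewrite ler_peMl ?(le_trans (ltW u01)) // mulr_ge0 // ltW.
(* Otherwise [W * W * (1 + eps)] is below [(1 - eps)^2 * (1 + eps) = 1 - eps - eps^2 * (1 - eps)],
   against [WW]. *)
have W_ge : 1 - eps <= W.
  rewrite leNgt; apply/negP => h.
  have : W * W < (1 - eps) * (1 - eps) by apply: ltr_pM => //; exact: ltW.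
  rewrite -(ltr_pM2r (x := 1 + eps)); last by rewrite ltr_wpDr.
  have : 0 <= eps * eps * (1 - eps) by rewrite !mulr_ge0 // ltW.
  move: eps_ge0; lra.
have ui0 : u0 <= u 0 i by exact: fmin_le.
have uiW : u 0 i <= W by rewrite -UW; exact: fmax_ge.
by rewrite ler_distl; apply/andP; split; move: epsE; lra.
Qed.

End ScalingPerturbation.

(** * Normalisation, a priori bounds and the final estimate *)

Lemma norm1_pos (R : realType) n (v : 'rV[R]_n) :
  positive_mx v -> norm1 v = \sum_i v 0 i.
Proof. by move=> v0; apply: eq_bigr => i _; rewrite gtr0_norm. Qed.

Lemma fmaxZ (R : realType) (I : finType) (i0 : I) (t : R) (F : I -> R) :
  0 <= t -> fmax i0 (fun i => t * F i) = t * fmax i0 F.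
Proof.
move=> t0; apply/eqP; rewrite eq_le; apply/andP; split.
  have [i ->] := fmax_attained i0 (fun i => t * F i).
  by rewrite ler_wpM2l // fmax_ge.
by have [i ->] := fmax_attained i0 F; exact: (fmax_ge _ (fun i => t * F i)).
Qed.

(** Scalings may be changed to [(t u, v / t)]; the choice [t = sqrt (V / U)] moves both maxima to
    [sqrt (U V)]. *)
Lemma balanced_scaling (R : realType) m n (i0 : 'I_m) (j0 : 'I_n)
    (A : 'M[R]_(m, n)) r c u v : scales A r c u v ->
  exists u' v', scales A r c u' v' /\ fmax i0 (u' 0) = fmax j0 (v' 0).
Proof.
case=> u_pos v_pos rows cols; set U := fmax i0 (u 0); set V := fmax j0 (v 0).
have U0 : 0 < U by apply: lt_le_trans (fmax_ge _ _ i0); exact: u_pos.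
have V0 : 0 < V by apply: lt_le_trans (fmax_ge _ _ j0); exact: v_pos.
pose t := Num.sqrt (V / U).
have t0 : 0 < t by rewrite sqrtr_gt0 divr_gt0.
have tuv i j : (t *: u) 0 i * A i j * (t^-1 *: v) 0 j = u 0 i * A i j * v 0 j.
  by rewrite !mxE; field; rewrite gt_eqF.
exists (t *: u), (t^-1 *: v); split.
  split=> [k i|k j|i|j].
  - by rewrite mxE mulr_gt0.
  - by rewrite mxE mulr_gt0 ?invr_gt0.
  - by under eq_bigr do rewrite tuv; exact: rows.
  - by under eq_bigr do rewrite tuv; exact: cols.
rewrite /fmax !mxE; under eq_bigr do rewrite mxE.
under [RHS]eq_bigr do rewrite mxE.
rewrite -!/(fmax _ _) !fmaxZ ?invr_ge0 ?(ltW t0) // -/U -/V.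
apply: (mulfI (lt0r_neq0 t0)); rewrite !mulrA -expr2 sqr_sqrtr ?divr_ge0 ?ltW //.
by rewrite divfK ?gt_eqF // divff ?mul1r ?gt_eqF.
Qed.

(** With [Su], [Sv] the sums of [u], [v]: [u_i a Sv <= r_i], [v_j a Su <= c_j], and the total mass
    is at most [b Su Sv]. Multiplying the first two and inserting the third eliminates [Su Sv]. *)
Lemma scaling_entry_le (R : realType) m n (a b : R) (A : 'M[R]_(m, n))
    r c u v i j :
  0 < a -> (forall i j, a <= A i j <= b) -> scales A r c u v ->
  u 0 i * v 0 j * (a ^+ 2 * \sum_i r 0 i) <= b * (r 0 i * c 0 j).
Proof.
move=> a0 Aab [u_pos v_pos rows cols].
set Su := \sum_i u 0 i; set Sv := \sum_j v 0 j.
have Su0 : 0 <= Su by apply: sumr_ge0 => k _; exact: ltW.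
have Sv0 : 0 <= Sv by apply: sumr_ge0 => k _; exact: ltW.
have b0 : 0 <= b.
  by have /andP[aA Ab] := Aab i j; apply: le_trans (le_trans aA Ab); exact: ltW.
have row_i : u 0 i * (a * Sv) <= r 0 i.
  rewrite -rows !mulr_sumr; apply: ler_sum => k _.
  rewrite mulrA ler_pM2r // ler_pM2l //.
  by have /andP[] := Aab i k.
have col_j : v 0 j * (a * Su) <= c 0 j.
  rewrite -cols !mulr_sumr; apply: ler_sum => k _.
  rewrite mulrC ler_pM2r // mulrC ler_pM2l //.
  by have /andP[] := Aab k j.
have total : \sum_i r 0 i <= b * (Su * Sv).
  rewrite mulr_suml mulr_sumr; apply: ler_sum => k _.
  rewrite -rows !mulr_sumr; apply: ler_sum => l _.
  rewrite mulrA ler_pM2r // mulrC ler_pM2r //.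
  by have /andP[] := Aab k l.
apply: le_trans (ler_wpM2l _ (ler_wpM2l _ total)) _.
- by rewrite mulr_ge0 // ltW.
- by rewrite exprn_ge0 // ltW.
rewrite [leLHS](_ : _ = b * ((u 0 i * (a * Sv)) * (v 0 j * (a * Su)))); last by ring.
apply: ler_wpM2l => //; apply: ler_pM => //;
  by rewrite !mulr_ge0 // ltW.
Qed.

Lemma powR3half (R : realType) (C : R) :
  0 <= C -> C `^ (3%:R / 2%:R) = C * Num.sqrt C.
Proof.
move=> C0; rewrite powRrM powR_mulrn // powR12_sqrt ?exprn_ge0 //.
by rewrite exprS sqrtrM // sqrtr_sqr ger0_norm // mulrC.
Qed.

(** The product of the instances for [x] and [y] turns the two square roots into [s], giving
    [C1 C2 r_i c_j <= s x_i y_j]. *)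
Lemma vmin_ratio (R : realType) n (n_gt0 : (0 < n)%N) (r x : 'rV[R]_n) :
  positive_mx r -> positive_mx x ->
  let C := vmin n_gt0 (\row_i (x 0 i / normalized r 0 i)) in
  0 < C /\ forall i, C * r 0 i <= Num.sqrt (norm1 r) * x 0 i.
Proof.
move=> r0 x0 C; have s0 : 0 < Num.sqrt (norm1 r).
  by rewrite sqrtr_gt0 norm1_pos // sumr_ord_gt0.
split=> [|i].
  by apply: fmin_gt => i; rewrite !mxE !divr_gt0.
have : C <= _ := fmin_le _ _ i.
by rewrite !mxE invf_div mulrA ler_pdivlMr // [x 0 i * _]mulrC.
Qed.

(** This makes [s / (n * min)] at least 1, which is how that factor enters the final bounds. *)
Lemma vmin_mean_le (R : realType) n (n_gt0 : (0 < n)%N) (r : 'rV[R]_n) :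
  n%:R * vmin n_gt0 r <= \sum_i r 0 i.
Proof.
rewrite mulr_natl -[X in _ *+ X]card_ord -sumr_const; apply: ler_sum => i _.
exact: fmin_le.
Qed.

Theorem lemma9 (R : realType) (M N : nat) (hM : (0 < M)%N) (hN : (0 < N)%N)
    (r : 'rV[R]_M) (c : 'rV[R]_N) (r_pos : positive_mx r) (c_pos : positive_mx c)
    (rc_norm : norm1 r = norm1 c)
    (A : 'M[R]_(M, N)) (A_pos : positive_mx A)
    (eps : R) (eps_gt0 : 0 < eps) (eps_lt1 : eps < 1)
    (x : 'rV[R]_M) (y : 'rV[R]_N) (x_pos : positive_mx x) (y_pos : positive_mx y)
    (col_approx : forall j : 'I_N,
       `|(c 0 j)^-1 * (\sum_(i < M) x 0 i * A i j * y 0 j) - 1| <= eps)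
    (row_approx : forall i : 'I_M,
       `|(r 0 i)^-1 * (\sum_(j < N) x 0 i * A i j * y 0 j) - 1| <= eps) :
  let s := norm1 r in
  let a := mx_min hM hN A in
  let b := mx_max hM hN A in
  let C1 := vmin hM (\row_(i < M) (x 0 i / normalized r 0 i)) in
  let C2 := vmin hN (\row_(j < N) (y 0 j / normalized c 0 j)) in
  exists (xt : 'rV[R]_M) (yt : 'rV[R]_N),
    [/\ scales A r c xt yt,
        forall i : 'I_M,
          `|xt 0 i - x 0 i| / x 0 i <=
            eps / (1 - eps)
            + (4%:R * eps * s * Num.sqrt b)
              / (a ^+ 2 * C1 `^ (3%:R / 2%:R) * C2 `^ (3%:R / 2%:R)
                 * M%:R * vmin hM r)
      & forall j : 'I_N,
          `|yt 0 j - y 0 j| / y 0 j <=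
            eps / (1 - eps)
            + (4%:R * eps * s * Num.sqrt b)
              / (a ^+ 2 * C1 `^ (3%:R / 2%:R) * C2 `^ (3%:R / 2%:R)
                 * N%:R * vmin hN c)].
Proof.
move=> s a b C1 C2.
have [C1_gt0 C1_le] := vmin_ratio hM r_pos x_pos.
have [C2_gt0 C2_le] := vmin_ratio hN c_pos y_pos.
rewrite -/C1 in C1_gt0 C1_le; rewrite -/C2 -rc_norm in C2_gt0 C2_le.
have sE : s = \sum_i r 0 i by exact: norm1_pos.
have sE' : s = \sum_j c 0 j by rewrite /s rc_norm norm1_pos.
have s_gt0 : 0 < s by rewrite sE sumr_ord_gt0.
have a_gt0 : 0 < a by apply: fmin_gt.
have aAb i j : a <= A i j <= b.
  by rewrite (fmin_le _ (fun ij => A ij.1 ij.2) (i, j))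
             (fmax_ge _ (fun ij => A ij.1 ij.2) (i, j)).
have b_gt0 : 0 < b.
  have /andP[aA Ab] := aAb (Ordinal hM) (Ordinal hN).
  exact: lt_le_trans a_gt0 (le_trans aA Ab).
(* Scaling [B] by [(u, v)] scales [A] by the entrywise products with [x] and [y], so the relative
   errors become [|u_i - 1|] and [|v_j - 1|]. *)
pose B := \matrix_(i, j) (x 0 i * A i j * y 0 j).
have B_pos : positive_mx B by move=> i j; rewrite mxE !mulr_gt0.
have B_row : row_near eps B r.
  by move=> i; under eq_bigr do rewrite mxE; exact: row_approx.
have B_col : row_near eps B^T c.
  by move=> j; under eq_bigr do rewrite !mxE; exact: col_approx.
pose q := a * C1 * C2.
have q_gt0 : 0 < q by rewrite !mulr_gt0.
have xy_ge i j : C1 * C2 * (r 0 i * c 0 j) <= s * (x 0 i * y 0 j).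
  rewrite mulrACA -[s in leRHS]sqr_sqrtr ?(ltW s_gt0) // expr2 [leRHS]mulrACA.
  by apply: ler_pM; rewrite ?mulr_ge0 // ltW.
have B_ge i j : q * r 0 i * c 0 j <= s * B i j.
  have /andP[aA _] := aAb i j.
  rewrite mxE [leLHS](_ : _ = a * (C1 * C2 * (r 0 i * c 0 j))); last first.
    by rewrite /q; ring.
  rewrite [leRHS](_ : _ = A i j * (s * (x 0 i * y 0 j))); last by ring.
  by apply: ler_pM; rewrite ?mulr_ge0 // ltW.
have [u0 [v0 Buv0]] := sinkhorn hM hN B_pos r_pos c_pos rc_norm.
have [u [v [Buv UV]]] := balanced_scaling (Ordinal hM) (Ordinal hN) Buv0.
set W := fmax _ (u 0) in UV.
have [u_pos v_pos rows cols] := Buv.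
pose xt := \row_i (x 0 i * u 0 i); pose yt := \row_j (y 0 j * v 0 j).
have BA i j : xt 0 i * A i j * yt 0 j = u 0 i * B i j * v 0 j.
  by rewrite !mxE; ring.
have Axy : scales A r c xt yt.
  split=> [k i|k j|i|j].
  - by rewrite mxE mulr_gt0 // (ord1 k).
  - by rewrite mxE mulr_gt0 // (ord1 k).
  - by under eq_bigr do rewrite BA; exact: rows.
  - by under eq_bigr do rewrite BA; exact: cols.
have W_gt0 : 0 < W by apply: lt_le_trans (fmax_ge _ _ (Ordinal hM)); exact: u_pos.
(* At maximisers [i], [j] the product [xt_i yt_j] is [W^2 x_i y_j]; it is bounded above by
   [scaling_entry_le], while [xy_ge] bounds [x_i y_j] below. *)
have WW : W ^+ 2 <= b / (a ^+ 2 * (C1 * C2)).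
  have [i EU] := fmax_attained (Ordinal hM) (u 0).
  have [j EV] := fmax_attained (Ordinal hN) (v 0).
  have rc_gt0 : 0 < r 0 i * c 0 j by rewrite mulr_gt0.
  rewrite ler_pdivlMr ?mulr_gt0 ?exprn_gt0 // -(ler_pM2r rc_gt0).
  apply: le_trans (scaling_entry_le i j a_gt0 aAb Axy).
  rewrite !mxE -EU -EV -/W -UV -sE.
  rewrite [leRHS](_ : _ = W ^+ 2 * a ^+ 2 * (s * (x 0 i * y 0 j))); last by ring.
  rewrite [leLHS](_ : _ = W ^+ 2 * a ^+ 2 * (C1 * C2 * (r 0 i * c 0 j))); last by ring.
  by rewrite ler_pM2l ?mulr_gt0 ?exprn_gt0.
set D := Num.sqrt b / (a ^+ 2 * C1 `^ (3%:R / 2%:R) * C2 `^ (3%:R / 2%:R)).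
have D_ge0 : 0 <= D.
  by rewrite divr_ge0 ?sqrtr_ge0 // !mulr_ge0 ?powR_ge0 // ltW.
(* The root of [WW] contributes [sqrt C1 * sqrt C2] and [q] contributes [C1 * C2]: together the
   exponents 3/2, and likewise [a] twice. *)
have WD : W / q <= D.
  rewrite /D !powR3half ?(ltW C1_gt0) ?(ltW C2_gt0) //.
  set d1 := Num.sqrt C1; set d2 := Num.sqrt C2.
  have d1_gt0 : 0 < d1 by rewrite sqrtr_gt0.
  have d2_gt0 : 0 < d2 by rewrite sqrtr_gt0.
  have Wle : W <= Num.sqrt b / (a * d1 * d2).
    have d_gt0 : 0 < Num.sqrt b / (a * d1 * d2).
      by rewrite divr_gt0 ?sqrtr_gt0 // !mulr_gt0.
    rewrite -ler_sqr ?nnegrE ?(ltW W_gt0) ?(ltW d_gt0) //.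
    rewrite expr_div_n !exprMn !sqr_sqrtr ?(ltW C1_gt0) ?(ltW C2_gt0) ?(ltW b_gt0) //.
    by rewrite -mulrA.
  rewrite ler_pdivrMr //; apply: (le_trans Wle).
  rewrite le_eqVlt; apply/orP; left; apply/eqP; rewrite /q; field.
  by rewrite !gt_eqF.
have err_le (t : R) (n : nat) (z : R) : (0 < n)%N -> 0 < z -> n%:R * z <= s ->
    t <= eps / (1 - eps) + 4 * eps * (W / q) ->
    t <= eps / (1 - eps) + (4%:R * eps * s * Num.sqrt b)
      / (a ^+ 2 * C1 `^ (3%:R / 2%:R) * C2 `^ (3%:R / 2%:R) * n%:R * z).
  move=> n_gt0 z_gt0 nz h; apply: (le_trans h); rewrite lerD2l.
  have nz_gt0 : 0 < n%:R * z by rewrite mulr_gt0 // ltr0n.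
  rewrite [leRHS](_ : _ = 4 * eps * (D * (s / (n%:R * z)))); last first.
    by rewrite /D -(mulrA _ n%:R z) (invfM _ (n%:R * z)); ring.
  rewrite ler_pM2l ?mulr_gt0 //; apply: (le_trans WD).
  by rewrite ler_peMr // ler_pdivlMr // mul1r.
have rel_errE (z w : R) : 0 < z -> `|z * w - z| / z = `|w - 1|.
  move=> z0; rewrite -{2}[z]mulr1 -mulrBr normrM gtr0_norm //.
  by rewrite mulrAC divff ?mul1r // gt_eqF.
exists xt, yt; split=> // [i|j].
  rewrite mxE rel_errE //; apply: err_le => //; first exact: fmin_gt.
    by rewrite sE vmin_mean_le.
  apply: (scaling_close (ltW eps_gt0) eps_lt1 q_gt0 B_pos r_pos c_pos B_row B_col
    _ Buv) => //.
  by move=> k l; rewrite -sE.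
rewrite mxE rel_errE //; apply: err_le => //; first exact: fmin_gt.
  by rewrite sE' vmin_mean_le.
(* The column bound is the row bound for [B^T], scaled by [(v, u)]; the minorisation is symmetric
   since [r] and [c] have the same sum [s]. *)
apply: (scaling_close (ltW eps_gt0) eps_lt1 q_gt0 (positive_mx_tr B_pos) c_pos
  r_pos B_col _ _ (tr_scales Buv)) => //; first by rewrite trmxK.
by move=> k l; rewrite -sE' mxE mulrAC.
Qed.
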